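(* Let $f$ be a maximal coupling function for the kernel $p$ on the alphabet $G$, $\mathbf{U}=\{U_i\}_{i\in\mathbf{Z}}$ i.i.d. uniform on $[0,1)$, and let $A_h$ and $K'$ be as defined below. Put $K'_j=\inf\{m\in\mathbf{N}:U_j<A_m(U_{j-1},\dots,U_{j-m})\}$ for $j\in\mathbf{Z}$, $\tau^{\mathbf{K}'}_n=\sup\{s\le n:K'_j\le j-s\ \text{for all } s\le j\le n\}$, and $R^{\mathbf{K}'}_0=\{\tau^{\mathbf{K}'}_n\ge0\ \text{for all } n\in\mathbf{N}\}$. If $$\prod_{h=0}^{\infty}A_h(U_{h-1},\dots,U_0)^{-1}\in\mathcal{L}^1,$$ then $P(R^{\mathbf{K}'}_0)>0$.
   Context: $G$ finite or countable; histories $\mathbf{w}=(w_{-1},w_{-2},\dots)\in G^{-\mathbf{N}^*}$; kernel $p(g|\mathbf{w})$ measurable in $\mathbf{w}$, summing to 1 over $g$. Admissible histories $\mathcal{H}$: a letter $g$ is forbidden if $p(g|\mathbf{w})=0$ for all $\mathbf{w}$; a word $(s_0,\dots,s_{-n})$ is forbidden if $(s_{-1},\dots,s_{-n})$ is forbidden or $p(s_0|\mathbf{w})=0$ for all histories beginning with $(s_{-1},\dots,s_{-n})$; $\mathbf{w}\in\mathcal{H}$ iff no initial word $(w_{-1},\dots,w_{-n})$ is forbidden. Maximal coupling function: $a_0(g)=\inf\{p(g|\mathbf{z}):\mathbf{z}\in\mathcal{H}\}$; for $k\ge1$, $a_k(g|w_{-1},\dots,w_{-k})=\inf\{p(g|\mathbf{z}):\mathbf{z}\in\mathcal{H},(z_{-1},\dots,z_{-k})=(w_{-1},\dots,w_{-k})\}$;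 $b_k=a_k-a_{k-1}$ (with $a_{-1}\equiv0$); $a_k(w_{-1},\dots,w_{-k})=\sum_ga_k(g|w_{-1},\dots,w_{-k})$, $a_0=\sum_ga_0(g)$. It is assumed that $a_k(w_{-1},\dots,w_{-k})\uparrow1$ for every $\mathbf{w}\in\mathcal{H}$. The interval $[a_{k-1}(w_{-1},\dots,w_{-k+1}),a_k(w_{-1},\dots,w_{-k}))$ is partitioned into subintervals $B_k(g|w_{-1},\dots,w_{-k})$ of length $b_k(g|w_{-1},\dots,w_{-k})$, $g\in G$ (for $k=0$, $[0,a_0)$ is partitioned into $B_0(g)$ of length $a_0(g)$), and $f(u|\mathbf{w})=g$ on $\bigcup_kB_k(g|w_{-1},\dots,w_{-k})$. $A_0=a_0$; for $h\ge1$ and $(u_1,\dots,u_h)\in[0,1)^h$, $A_h(u_1,\dots,u_h)=\inf\{a_h(w_{-1},\dots,w_{-h}):\mathbf{w}\in J_h(u_1,\dots,u_h)\}$ where $J_h(u_1,\dots,u_h)=\{\mathbf{w}\in\mathcal{H}:w_{-k}=g \text{ whenever } u_k\in B_0(g),\ g\in G,\ 1\le k\le h\}$. Thus $A_h(U_{h-1},\dots,U_0)$ is $A_h$ evaluated at $(u_1,\dots,u_h)=(U_{h-1},\dots,U_0)$. *)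

(* Defs.v *)
From HB Require Import structures.
From mathcomp Require Import all_boot all_order all_algebra.
From mathcomp Require Import all_classical all_reals all_analysis.
Set Implicit Arguments. Unset Strict Implicit. Unset Printing Implicit Defensive.
Import Order.TTheory GRing.Theory Num.Theory.
Import numFieldNormedType.Exports.
Local Open Scope classical_set_scope.
Local Open Scope ring_scope.

(* Conventions: a history w = (w_{-1}, w_{-2}, ...) is a function
   w : nat -> G with  w i = w_{-(i+1)}.  A kernel is p : G -> (nat -> G) -> R,
   p g w = p(g | w). *)

Section Coupling.
Variables (R : realType) (G : countType) (p : G -> (nat -> G) -> R).

Definition cylinders : set (set (nat -> G)) :=
  [set A | exists i g, A = [set w | w i = g]].

(* forbidden words: the word (s_0, s_{-1}, ..., s_{-n}) is the list
   [:: s_0; s_{-1}; ...; s_{-n}] *)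
Fixpoint forbidden (s : seq G) : Prop :=
  match s with
  | [::] => False
  | s0 :: r => forbidden r \/
      (forall z : nat -> G, (forall i, (i < size r)%N -> z i = nth s0 r i) ->
         p s0 z = 0)
  end.

Definition admissible (w : nat -> G) : Prop :=
  forall n, ~ forbidden (mkseq w n).

Definition Hadm : set (nat -> G) := [set w | admissible w].

Definition a_g (k : nat) (g : G) (w : nat -> G) : R :=
  inf [set p g z | z in [set z | admissible z /\ forall i, (i < k)%N -> z i = w i]].

Definition a_sum (k : nat) (w : nat -> G) : R :=
  fine (\esum_(g in [set: G]) (a_g k g w)%:E)%E.

(* a_0(g) (k = 0: no constraint on the history, the dummy argument is irrelevant) *)
Definition a0 (g : G) : R := a_g 0 g (fun=> g).

Definition a0sum : R := fine (\esum_(g in [set: G]) (a0 g)%:E)%E.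

Definition B0 (l : G -> R) (g : G) : set R :=
  [set x | l g <= x < l g + a0 g].

(* J_h(u_1,...,u_h), u given as u : nat -> R with u k = u_k (k >= 1) *)
Definition J (l : G -> R) (h : nat) (u : nat -> R) : set (nat -> G) :=
  [set w | admissible w /\ forall k, (1 <= k <= h)%N ->
     forall g, B0 l g (u k) -> w k.-1 = g].

Definition A (l : G -> R) (h : nat) (u : nat -> R) : R :=
  inf [set a_sum h w | w in J l h u].

End Coupling.

Section Prob.
Variables (d : measure_display) (Omega : measurableType d) (R : realType)
  (P : probability Omega R).

Definition iid_uniform01 (U : int -> Omega -> R) : Prop :=
  (forall i, measurable_fun setT (U i)) /\
  (forall i (B : set R), measurable B ->
     P (U i @^-1` B) = lebesgue_measure (B `&` [set x | 0 <= x < 1])) /\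
  (forall (I : seq int) (B : int -> set R), uniq I ->
     (forall i, measurable (B i)) ->
     P (\bigcap_(i in [set` I]) (U i @^-1` B i)) =
     (\prod_(i <- I) P (U i @^-1` B i))%E).

End Prob.

Definition einv {R : realType} (x : R) : \bar R :=
  if x == 0 then +oo%E else (x^-1)%:E.

(* Main.v *)
Require Import Defs.
From HB Require Import structures.
From mathcomp Require Import all_boot all_order all_algebra.
From mathcomp Require Import all_classical all_reals all_analysis.
From mathcomp Require Import measurable_realfun.
Import Order.TTheory GRing.Theory Num.Theory.
Import numFieldNormedType.Exports.
Local Open Scope classical_set_scope.
Local Open Scope ring_scope.

(** R^{K'}_0 contains E = {U_h < A_h(U_{h-1},...,U_0) for all h >= 0}, since then
    s = 0 witnesses tau_n >= 0 for every n.  Let E_n be the same event for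
    h < n and let Pi_n be the product of the A_h^{-1} over h < n.  Given
    U_0,...,U_{n-1}, the event U_n < A_n has probability A_n, which cancels the
    new factor of Pi_{n+1}; hence E[1_{E_n} Pi_n] >= 1 for all n.  If P(E) = 0,
    then E[1_{E_n} Pi] would tend to 0 for the integrable full product Pi.
    No conditional expectations are needed: A_h sees the past only through the
    cells B_0(g) visited, hence through a word over a countable alphabet, and on
    a fixed word E_n is a product event. *)

(** * Success events driven by a past recorded in a countable alphabet *)

Section DiscretePast.
Context {d : measure_display} {Omega : measurableType d} {R : realType}.
Variable P : probability Omega R.
Variables (C : countType) (cell : R -> C).
Hypothesis cell_meas : forall c, measurable (cell @^-1` [set c]).
Variable V : nat -> Omega -> R.
Hypothesis V_meas : forall i, measurable_fun setT (V i).
Hypothesis V_unif : forall i a, 0 <= a <= 1 ->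
  P (V i @^-1` [set x | x < a]) = a%:E.
Hypothesis V_indep : forall n (B : nat -> set R), (forall i, measurable (B i)) ->
  P [set om | forall i, (i < n)%N -> B i (V i om)] =
  (\prod_(i < n) P (V i @^-1` B i))%E.
Variable alpha : seq C -> R.
Hypothesis alpha01 : forall c, 0 <= alpha c <= 1.

(* Oldest letter first, unlike the words of the paper. *)
Let word n om := mkseq (fun i => cell (V i om)) n.

Let fiber n c := word n @^-1` [set c].

Let success n : set Omega :=
  [set om | forall h, (h < n)%N -> V h om < alpha (word h om)].

(** Only proper prefixes of [c] enter; [weight (word n om)] is the partial product Pi_n. *)
Let weight (c : seq C) : \bar R := (\prod_(h < size c) einv (alpha (take h c)))%E.

(** The union runs over all of the countable type [I]; the constant sets [[set om | Y c]], each full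
    or empty, select the values in [Y]. *)
Lemma measurable_preimage_countable (I : countType) (X : Omega -> I) (Y : set I) :
  (forall c, measurable (X @^-1` [set c])) -> measurable (X @^-1` Y).
Proof.
move=> mX; rewrite (_ : _ @^-1` _ = \bigcup_c ((X @^-1` [set c]) `&` [set om | Y c])).
  apply: countable_bigcupT_measurable => [|c]; first exact: countableP.
  have [Yc|nYc] := pselect (Y c).
    by rewrite (_ : [set _ | _] = setT) ?setIT//; apply/seteqP; split.
  by rewrite (_ : [set _ | _] = set0) ?setI0//; apply/seteqP; split.
by apply/seteqP; split => [om Yom|om [c _ [/= -> ]]//]; exists (X om).
Qed.

(** The index list is arbitrary so as to serve both [word n] and words read backwards from any
    integer time. *)
Lemma measurable_map_cells (I : Type) (X : I -> Omega -> R) (s : seq I)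
    (c : seq C) : (forall i, measurable_fun setT (X i)) ->
  measurable ((fun om => [seq cell (X i om) | i <- s]) @^-1` [set c]).
Proof.
move=> mX; elim: s c => [|i s IH] [|x c].
- by rewrite (_ : _ @^-1` _ = setT)//; apply/seteqP; split.
- by rewrite (_ : _ @^-1` _ = set0)//; apply/seteqP; split.
- by rewrite (_ : _ @^-1` _ = set0)//; apply/seteqP; split.
rewrite (_ : _ @^-1` _ = (X i @^-1` (cell @^-1` [set x])) `&`
   ((fun om => [seq cell (X i om) | i <- s]) @^-1` [set c])).
  by apply: measurableI => //; rewrite -[X in measurable X]setTI; exact: mX.
by apply/seteqP; split => om /= [-> ->].
Qed.

Lemma measurable_word_comp {d'} {T : measurableType d'} n (g : seq C -> T) :
  measurable_fun setT (g \o word n).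
Proof.
move=> _ B mB; rewrite setTI comp_preimage.
by apply: measurable_preimage_countable => c; exact: measurable_map_cells.
Qed.

Lemma measurable_fiber n c : measurable (fiber n c).
Proof. exact: measurable_map_cells. Qed.

Lemma successS n :
  success n.+1 = success n `&` [set om | V n om < alpha (word n om)].
Proof.
apply/seteqP; split => om /=.
  by move=> H; split => [h hn|]; apply: H => //; exact: ltnW.
by move=> [Hn H] h; rewrite ltnS leq_eqVlt => /predU1P[->//|/Hn].
Qed.

Lemma measurable_success n : measurable (success n).
Proof.
elim: n => [|n IH]; first by rewrite (_ : success 0 = setT)//; apply/seteqP; split.
rewrite successS; apply: measurableI => //.
have := measurable_fun_ltr (V_meas n) (measurable_word_comp n alpha).
by move=> /(_ measurableT [set true] I); rewrite setTI preimage_true.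
Qed.

Lemma einv_ge1 (x : R) : 0 <= x <= 1 -> (1 <= einv x)%E.
Proof.
move=> /andP[x0 x1]; rewrite /einv; case: ifPn => [_|x_neq0]; first exact: leey.
by rewrite lee_fin invf_ge1 // lt_neqAle eq_sym x_neq0.
Qed.

Lemma weight_ge1 c : (1 <= weight c)%E.
Proof.
rewrite /weight; elim/big_ind : _ => // [x y x1 y1|i _]; last exact: einv_ge1.
by rewrite -[1%E]mule1 lee_pmul.
Qed.

Lemma weight_ge0 c : (0 <= weight c)%E.
Proof. exact: le_trans (weight_ge1 c). Qed.

Lemma size_word n om : size (word n om) = n.
Proof. exact: size_mkseq. Qed.

Lemma wordS n om : word n.+1 om = rcons (word n om) (cell (V n om)).
Proof. by rewrite /word /mkseq -addn1 iotaD map_cat cats1. Qed.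

Lemma weight_rcons c x : weight (rcons c x) = (weight c * einv (alpha c))%E.
Proof.
rewrite /weight size_rcons big_ord_recr/= -cats1 take_size_cat//; congr (_ * _)%E.
by apply: eq_bigr => i _; rewrite takel_cat// ltnW.
Qed.

Lemma take_word n h om : (h <= n)%N -> take h (word n om) = word h om.
Proof. by move=> hn; rewrite /word /mkseq -map_take take_iota (minn_idPl hn). Qed.

(** On a fibre every threshold [alpha (word h om)] with [h < n] is a constant, so the past event
    constrains each [V i] separately and independence splits off the condition on [V n]. *)
Lemma fiber_success_indep n c a : 0 <= a <= 1 ->
  P (fiber n c `&` success n `&` V n @^-1` [set x | x < a]) =
  (P (fiber n c `&` success n) * a%:E)%E.
Proof.
move=> a01.
have [->|/set0P[om0 [/= wom0 som0]]] := eqVneq (fiber n c `&` success n) set0.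
  by rewrite set0I measure0 mul0e.
(* The thresholds are frozen at a sample point [om0] of the event; index [n] carries the new
   constraint. *)
pose B i := if (i < n)%N then
  cell @^-1` [set cell (V i om0)] `&` [set x | x < alpha (word i om0)]
  else [set x | x < a].
have mltR b : measurable [set x : R | x < b].
  by have := @measurable_itv R `]-oo, b[; rewrite set_itvE.
have mB i : measurable (B i).
  by rewrite /B; case: ifP => _ //; exact: measurableI.
have E1 : fiber n c `&` success n = [set om | forall i, (i < n)%N -> B i (V i om)].
  apply/seteqP; split => om /=.
    rewrite -wom0 => -[] wE som i lin; rewrite /B lin/=.
    rewrite -(take_word n i om0 (ltnW lin)) -[word n om0]wE take_word ?(ltnW lin)//.
    split; last exact: som.
    have := congr1 (fun s => nth (cell 0) s i) wE.
    by rewrite /word !nth_mkseq.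
  move=> H.
  (* Equal cells give equal words, so the thresholds frozen at [om0] are also those of [om]. *)
  have cE i : (i < n)%N -> cell (V i om) = cell (V i om0).
    by move=> lin; have := H i lin; rewrite /B lin => -[].
  have wE h : (h <= n)%N -> word h om = word h om0.
    move=> hn; apply/eq_in_map => i; rewrite mem_iota => /andP[_ ih].
    exact/cE/(leq_trans ih).
  split; first by rewrite /fiber/= wE// wom0.
  by move=> h hn; have := H h hn; rewrite /B hn (wE h (ltnW hn)) => -[].
have E2 : fiber n c `&` success n `&` V n @^-1` [set x | x < a] =
   [set om | forall i, (i < n.+1)%N -> B i (V i om)].
  rewrite E1; apply/seteqP; split => om /=.
    move=> [H Ha] i; rewrite ltnS leq_eqVlt => /predU1P[->|/H//].
    by rewrite /B ltnn.
  move=> H; split; first by move=> i lin; apply: H; exact: ltnW.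
  by have := H n (ltnSn n); rewrite /B ltnn.
rewrite E2 E1 !V_indep// big_ord_recr/=; congr (_ * _)%E.
by rewrite /B ltnn V_unif.
Qed.

Lemma measurable_weight n : measurable_fun setT (fun om => weight (word n om)).
Proof. exact: measurable_word_comp. Qed.

(** Both integrands are constant on the fibre. Passing to [n.+1] costs a factor [alpha c] in
    probability and gains [einv (alpha c)] in weight, and these cancel when [alpha c] is nonzero. *)
Lemma integral_weight_fiber n c : size c = n -> (alpha c = 0 -> P (fiber n c) = 0%E) ->
  (\int[P]_(om in success n `&` fiber n c) weight (word n om) <=
   \int[P]_(om in success n.+1 `&` fiber n c) weight (word n.+1 om))%E.
Proof.
move=> sc null.
have mS m : measurable (success m `&` fiber n c).
  by apply: measurableI; [exact: measurable_success|exact: measurable_fiber].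
(* When [alpha c = 0] success at time [n] has probability 0, so nothing cancels: the left side must
   vanish too, and [null] ensures it. *)
have [a0|a0] := eqVneq (alpha c) 0.
  have PN : P (success n `&` fiber n c) = 0%E.
    apply/eqP; rewrite eq_le measure_ge0 andbT -(null a0).
    by apply: le_measure; rewrite ?inE//; exact: measurable_fiber.
  rewrite null_set_integral//; last exact: measurable_funTS (measurable_weight n).
  by apply: integral_ge0 => om _; exact: weight_ge0.
rewrite (eq_integral (cst (weight c))); last first.
  by move=> om; rewrite inE => -[_ /= ->].
rewrite [leRHS](eq_integral (cst (weight c * einv (alpha c))%E)); last first.
  by move=> om; rewrite inE => -[_ /= <-]; rewrite wordS weight_rcons.
rewrite !integral_cst//.
rewrite (_ : success n.+1 `&` fiber n c =
    fiber n c `&` success n `&` V n @^-1` [set x | x < alpha c]); last first.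
  rewrite successS setIAC (setIC (success n)).
  by apply/seteqP; split => om [] [/= wom som]; rewrite wom.
rewrite [X in (_ <= _ * X)%E]fiber_success_indep// setIC.
rewrite -muleA /einv (negbTE a0) (muleC (P _)) !muleA -(muleA (weight c)) -EFinM.
by rewrite mulVf// mule1.
Qed.


Lemma success_fiberE m n : success m = \bigcup_k
  (success m `&` (fun om => pickle (word n om)) @^-1` [set k]).
Proof.
by apply/seteqP; split => [om som|om [k _ []//]]; exists (pickle (word n om)).
Qed.

(** The series is indexed by naturals, hence the codes [pickle]. Keeping [m] and [n] separate lets
    the integrals for [n] and [n.+1] be split along the same words of length [n]. *)
Lemma integral_weight_successE m n :
  (\int[P]_(om in success m) weight (word m om) =
   \sum_(k <oo) \int[P]_(om in success m `&`
     (fun om => pickle (word n om)) @^-1` [set k]) weight (word m om))%E.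
Proof.
rewrite {1}(success_fiberE m n) ge0_integral_bigcup//.
- move=> k; apply: measurableI; first exact: measurable_success.
  exact: (measurable_preimage_countable _ (word n) (pickle @^-1` [set k])
    (measurable_fiber n)).
- exact: measurable_funTS (measurable_weight m).
- by move=> om _; exact: weight_ge0.
- apply/trivIsetP => i j _ _ ij; apply/seteqP; split=> om //= -[[_ +] [_ +]].
  by move=> -> /eqP; rewrite (negbTE ij).
Qed.

Hypothesis Pi_int :
  P.-integrable setT (fun om => ereal_sup (range (fun n => weight (word n om)))).

Let Pi om := ereal_sup (range (fun n => weight (word n om))).

(** On this fibre the factor [einv 0 = +oo] makes the whole product infinite. *)
Lemma fiber_null n c : size c = n -> alpha c = 0 -> P (fiber n c) = 0%E.
Proof.
move=> sc a0; have := integrable_ae measurableT Pi_int.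
move=> [N [mN PN subN]]; apply/eqP; rewrite eq_le measure_ge0 andbT -PN.
apply: le_measure; rewrite ?inE//; first exact: measurable_fiber.
move=> om /= wom; apply: subN => /= /(_ I).
suff PiE : Pi om = +oo%E by rewrite -/(Pi om) PiE.
apply/eqP; rewrite -leye_eq; apply: ereal_sup_ubound; exists n.+1 => //.
rewrite wordS [word n om]wom weight_rcons /einv a0 eqxx gt0_muley//.
exact: lt_le_trans (weight_ge1 c).
Qed.

Lemma integral_weight_success_ge1 n :
  (1 <= \int[P]_(om in success n) weight (word n om))%E.
Proof.
elim: n => [|n IH].
  rewrite (_ : success 0 = setT); last by apply/seteqP; split.
  rewrite (eq_integral (cst 1%E)); last by move=> om _; rewrite /weight big_ord0.
  by rewrite integral_cst// [X in (_ * X)%E]probability_setT mule1.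
apply: (le_trans IH).
rewrite (integral_weight_successE _ n).
rewrite (integral_weight_successE _ n).
apply: lee_nneseries => [k _ _|k _].
  by apply: integral_ge0 => om _; exact: weight_ge0.
(* A code [k] is either attained nowhere or, by injectivity of [pickle], attained on a single
   fibre. *)
pose F := (fun om => pickle (word n om)) @^-1` [set k]; rewrite -!/F.
have [->|/set0P[om0 Fom0]] := eqVneq F set0.
  by rewrite !setI0 !integral_set0 lexx.
have -> : F = fiber n (word n om0).
  apply/seteqP; split => om; rewrite /F /= -Fom0; last by move=> ->.
  by move/(pcan_inj pickleK).
by apply: integral_weight_fiber; [exact: size_word|exact/fiber_null/size_word].
Qed.

Lemma success_forever_gt0 : (0 < P (\bigcap_n success n))%E.
Proof.
have mPi : measurable_fun setT Pi by case/integrableP: Pi_int.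
have mS := measurable_success.
have Pi0 om : (0 <= Pi om)%E.
  by apply: le_trans (weight_ge0 (word 0 om)) _; apply: ereal_sup_ubound; exists 0.
have mSoo : measurable (\bigcap_n success n) by exact: bigcapT_measurable.
rewrite lt_neqAle measure_ge0 andbT; apply/eqP => /esym PS0.
(* [Pi] dominates each partial product, whose integral over [success n] is at least 1. *)
have S1 n : (1 <= \int[P]_(om in success n) Pi om)%E.
  apply: le_trans (integral_weight_success_ge1 n) _; apply: ge0_le_integral => //.
  - by move=> om _; exact: weight_ge0.
  - exact: measurable_funTS (measurable_weight n).
  - exact: measurable_funTS.
  - by move=> om _; apply: ereal_sup_ubound; exists n.
have iPi : (\int[P]_om Pi om)%E \is a fin_num by exact: integrable_fin_num.
have split A : measurable A ->
    (\int[P]_om Pi om = \int[P]_(om in A) Pi om + \int[P]_(om in ~` A) Pi om)%E.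
  move=> mA; rewrite -ge0_integral_setU ?setUv//.
  - exact: measurableC.
  - by rewrite disj_set2E setICr.
(* The failure sets increase to the complement of a null event, so their integrals exhaust that of
   [Pi]. *)
have cvgC : (\int[P]_(om in ~` success n) Pi om)%E @[n --> \oo] -->
    (\int[P]_om Pi om)%E.
  rewrite (split _ mSoo) null_set_integral//; last exact: measurable_funTS.
  rewrite add0e setC_bigcap.
  apply: ge0_nondecreasing_set_cvg_integral => //.
  - apply/nondecreasing_seqP => n; rewrite subsetEset; apply: subsetC => om som h hn.
    exact/som/ltnW.
  - by move=> n; exact: measurableC.
  - by move=> n; exact: measurable_funTS.
(* Yet by [S1] each of them falls short by at least 1, which is absurd since the integral of [Pi] is
   finite. *)
have : (\int[P]_om Pi om <= \int[P]_om Pi om - 1)%E.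
  rewrite -(cvg_lim _ cvgC)//; apply: lime_le; first by apply/cvg_ex; eexists; exact: cvgC.
  apply: nearW => n; rewrite (cvg_lim _ cvgC)//.
  rewrite leeBrDr//.
  rewrite [leRHS](split _ (mS n)) addeC; apply: leeD => //.
rewrite leNgt; apply/negP; rewrite negbK.
by rewrite lteBlDr// lteDl// lte_fin.
Qed.

End DiscretePast.

(** * Infima of naturals, suprema of integers and renewal times *)

Lemma ereal_inf_nat_le {R : realType} (Q : nat -> Prop) (t : nat) :
  (ereal_inf [set (m%:R : R)%:E | m in [set m | Q m]] <= t%:R%:E)%E <->
  exists m, (m <= t)%N /\ Q m.
Proof.
split=> [|[m [mt Qm]]]; last first.
  apply: (@le_trans _ _ (m%:R : R)%:E); last by rewrite lee_fin ler_nat.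
  by apply: ereal_inf_lbound; exists m.
apply: contraPP => noQ; apply/negP; rewrite -ltNge.
(* Without a witness up to [t] every element is at least [t.+1]; an empty set, with infimum +oo, is
   covered as well. *)
apply: (@lt_le_trans _ _ (t.+1%:R : R)%:E); first by rewrite lte_fin ltr_nat.
apply: le_ereal_inf_tmp => _ [m Qm <-]; rewrite lee_fin ler_nat ltnNge.
by apply/negP => mt; apply: noQ; exists m.
Qed.

Lemma ereal_sup_int_ge0 {R : realType} (Q : int -> Prop) :
  (0 <= ereal_sup [set (s%:~R : R)%:E | s in [set s | Q s]])%E <->
  exists s : nat, Q s%:Z.
Proof.
split=> [|[s Qs]]; last first.
  apply: (@le_trans _ _ (s%:~R : R)%:E); first by rewrite lee_fin ler0z.
  by apply: ereal_sup_ubound; exists s.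
apply: contraPP => noQ; apply/negP; rewrite -ltNge.
(* Negative integers are at most -1, so they cannot approach 0. *)
apply: (@le_lt_trans _ _ (-1 : R)%:E); last by rewrite lte_fin ltrN10.
apply: ge_ereal_sup => _ [[s|s] Qs <-]; first by exfalso; apply: noQ; exists s.
by rewrite lee_fin NegzE mulrNz lerN2 ler1z.
Qed.

(** Trades the extended-real infimum and supremum for quantifiers over naturals, which later exhibit
    the renewal event as a countable combination of measurable events. *)
Lemma renewal_ge0 {R : realType} (hit : nat -> int -> Prop) (n : nat) :
  let K j : \bar R := ereal_inf [set (m%:R : R)%:E | m in [set m | hit m j]] in
  (0 <= ereal_sup [set (s%:~R : R)%:E | s in
    [set s : int | (s <= n%:Z)%R /\
      forall j : int, (s <= j <= n%:Z)%R -> (K j <= ((j - s)%:~R)%:E)%E]])%E <->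
  exists s : nat, (s <= n)%N /\ forall j : nat, (s <= j <= n)%N ->
    exists m, (m <= j - s)%N /\ hit m j%:Z.
Proof.
move=> K; split.
  move=> /ereal_sup_int_ge0[s [sn H]]; exists s; split => // j /andP[sj jn].
  apply/(@ereal_inf_nat_le R); have := H j%:Z.
  by rewrite subzn// pmulrn; apply; apply/andP; split.
move=> [s [sn H]]; apply/ereal_sup_int_ge0; exists s; split => // -[j|j] //.
  move=> /andP[sj jn]; rewrite subzn//; apply/ereal_inf_nat_le/H.
  by apply/andP; split.
Qed.

(** * Uniform law and independence along nonnegative times *)

Section IidUniform.
Context {d : measure_display} {Omega : measurableType d} {R : realType}.
Variables (P : probability Omega R) (U : int -> Omega -> R).
Hypothesis HU : iid_uniform01 P U.

Lemma uniform_lt i a : 0 <= a <= 1 -> P (U i @^-1` [set x | x < a]) = a%:E.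
Proof.
move=> /andP[a0 a1]; have [_ [Ud _]] := HU.
rewrite Ud; last by have := @measurable_itv R `]-oo, a[; rewrite set_itvE.
rewrite (_ : _ `&` _ = [set` `[0, a[]).
  rewrite lebesgue_measure_itv/= lte_fin sube0; case: ifPn => //.
  by rewrite -leNgt => a0'; congr EFin; apply/eqP; rewrite eq_le a0 a0'.
apply/seteqP; split => x /=; rewrite in_itv/=.
  by move=> [xa /andP[-> _]].
by move=> /andP[-> xa]; split => //; exact: lt_le_trans a1.
Qed.

Lemma indep_nat n (B : nat -> set R) : (forall i, measurable (B i)) ->
  P [set om | forall i, (i < n)%N -> B i (U i%:Z om)] =
  (\prod_(i < n) P (U i%:Z @^-1` B i))%E.
Proof.
move=> mB; have [_ [_ Ui]] := HU.
(* The absolute value extends the family [B] from naturals to integers. *)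
have := Ui (map Posz (index_iota 0 n)) (fun z => B `|z|%N).
rewrite big_map big_mkord => <- //.
  congr (P _); apply/seteqP; split => om /=.
    by move=> H _ /mapP[i + ->]; rewrite mem_index_iota => /andP[_ /H].
  by move=> H i lin; apply: (H i%:Z); apply/mapP; exists i; rewrite // mem_index_iota.
by rewrite map_inj_uniq ?iota_uniq// => i j [].
Qed.

End IidUniform.

(** * A_h as a function of the word of visited cells *)

Section CellWords.
Context {R : realType} {G : countType}.
Variables (p : G -> (nat -> G) -> R) (l : G -> R).
Hypothesis p_ge0 : forall g w, 0 <= p g w.
Hypothesis p_sum1 : forall w, (\esum_(g in [set: G]) (p g w)%:E = 1)%E.
Hypothesis B0_disj : forall g g', g != g' -> B0 p l g `&` B0 p l g' = set0.

(** The choice made by [cid] is unambiguous because the B_0(g) are disjoint; [option G] is the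
    countable alphabet of the past. *)
Definition B0_cell (x : R) : option G :=
  if pselect (exists g, B0 p l g x) is left e then Some (sval (cid e)) else None.

Lemma B0_cellP x g : B0_cell x = Some g <-> B0 p l g x.
Proof.
rewrite /B0_cell; case: pselect => [e|ne]; last first.
  by split => // Bg; exfalso; apply: ne; exists g.
case: cid => g' /= Bg'; split => [[<-]//|Bg]; congr Some.
apply/eqP/negPn/negP => gg'; have := B0_disj _ _ gg'.
by move/seteqP => [/(_ x) + _]; apply.
Qed.

Lemma measurable_B0_cell c : measurable (B0_cell @^-1` [set c]).
Proof.
have mB g : measurable (B0 p l g).
  rewrite (_ : B0 p l g = [set` `[l g, l g + a0 p g[]); first exact: measurable_itv.
  by apply/seteqP; split => x /=; rewrite in_itv.
case: c => [g|].
  by rewrite (_ : _ @^-1` _ = B0 p l g)//; apply/seteqP; split => x /B0_cellP.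
rewrite (_ : _ @^-1` _ = ~` (\bigcup_g B0 p l g)).
  by apply/measurableC/countable_bigcupT_measurable => //; exact: countableP.
apply/seteqP; split => x /=.
  by move=> xN [g _ /B0_cellP]; rewrite xN.
case E : (B0_cell x) => [g|//] H; exfalso; apply: H.
by exists g => //; apply/B0_cellP.
Qed.

(** [c] lists the cells of u_1, u_2, ... in this order, most recent letter first;
    [None] marks a u_k outside every B_0(g). *)
Definition A_word (c : seq (option G)) : R :=
  inf [set a_sum p (size c) w | w in [set w | admissible p w /\
    forall k g, (k < size c)%N -> nth None c k = Some g -> w k = g]].

(** [J] tests u only through membership in the B_0(g). Letter [k] of the word stands for u_{k+1} and
    constrains [w k], that is w_{-(k+1)}. *)
Lemma A_wordE h (u : nat -> R) :
  A p l h u = A_word (mkseq (fun k => B0_cell (u k.+1)) h).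
Proof.
rewrite /A /A_word size_mkseq; congr (inf (_ @` _)).
apply/seteqP; split => w [adm H]; split => //.
  move=> k g kh; rewrite nth_mkseq// => /B0_cellP Bg.
  exact: (H k.+1).
move=> [|k]// /andP[_ kh] g Bg /=; apply: H => //.
by rewrite nth_mkseq//; exact/B0_cellP.
Qed.

Lemma inf_ge0 (S : set R) : (forall x, S x -> 0 <= x) -> 0 <= inf S.
Proof.
move=> S0; have [->|/set0P nS] := eqVneq S set0; first by rewrite inf0.
exact: lb_le_inf.
Qed.

Lemma a_g_ge0 k g w : 0 <= a_g p k g w.
Proof. by apply: inf_ge0 => _ [z _ <-]. Qed.

Lemma a_g_le k g w : admissible p w -> a_g p k g w <= p g w.
Proof.
move=> adm; apply: ge_inf; last by exists w.
by exists 0 => _ [z _ <-].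
Qed.

Lemma a_sum_ge0 k w : 0 <= a_sum p k w.
Proof. by apply/fine_ge0/esum_ge0 => g _; rewrite lee_fin a_g_ge0. Qed.

Lemma a_sum_le1 k w : admissible p w -> a_sum p k w <= 1.
Proof.
move=> adm.
have s0 : (0 <= \esum_(g in [set: G]) (a_g p k g w)%:E)%E.
  by apply: esum_ge0 => g _; rewrite lee_fin a_g_ge0.
have s1 : (\esum_(g in [set: G]) (a_g p k g w)%:E <= 1)%E.
  by rewrite -(p_sum1 w); apply: le_esum => g _; rewrite lee_fin a_g_le.
rewrite -lee_fin /a_sum fineK// ge0_fin_numE//.
exact: le_lt_trans s1 (ltry _).
Qed.

Lemma A_word01 c : 0 <= A_word c <= 1.
Proof.
apply/andP; split; first by apply: inf_ge0 => _ [w _ <-]; exact: a_sum_ge0.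
rewrite /A_word; set D := [set w | _].
(* If no admissible history fits [c], the infimum takes its default value 0, still at most 1. *)
have [->|/set0P[w Dw]] := eqVneq D set0; first by rewrite image_set0 inf0.
apply: le_trans (a_sum_le1 (size c) w Dw.1).
apply: ge_inf; last by exists w.
by exists 0 => _ [z _ <-]; exact: a_sum_ge0.
Qed.

End CellWords.

(** * Positive probability of the renewal event *)

Theorem theorem1 (R : realType) (G : countType) (p : G -> (nat -> G) -> R)
  (* p is a probability kernel, measurable in the history *)
  (p_ge0 : forall g w, 0 <= p g w)
  (p_sum1 : forall w, (\esum_(g in [set: G]) (p g w)%:E = 1)%E)
  (p_meas : forall g (B : set R), measurable B ->
     <<s @cylinders G >> ((fun w => p g w) @^-1` B))
  (H_nonempty : exists w, admissible p w)
  (* standing assumption: a_k(w_{-1},...,w_{-k}) increases to 1 on admissible w *)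
  (a_cvg : forall w, admissible p w -> (fun k => a_sum p k w) @ \oo --> (1 : R))
  (* [0, a_0) partitioned into the intervals B_0(g) = [l g, l g + a_0(g)) *)
  (l : G -> R)
  (B0_sub : forall g, B0 p l g `<=` [set x | 0 <= x < a0sum p])
  (B0_disj : forall g g', g != g' -> B0 p l g `&` B0 p l g' = set0)
  (B0_cover : [set x | 0 <= x < a0sum p] `<=` \bigcup_(g in [set: G]) B0 p l g)
  (* U = (U_i)_{i in Z} i.i.d. uniform on [0,1) *)
  (d : measure_display) (Omega : measurableType d) (P : probability Omega R)
  (U : int -> Omega -> R) (HU : iid_uniform01 P U) :
  let Ah (h : nat) (j : int) (om : Omega) : R :=
    (* A_h(U_{j-1}, ..., U_{j-h}) *)
    A p l h (fun k : nat => U (j - k%:Z) om) in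
  let prodinv (om : Omega) : \bar R :=
    (* prod_{h >= 0} A_h(U_{h-1}, ..., U_0)^{-1}, factors in [1, +oo] *)
    ereal_sup (range (fun n : nat =>
      (\prod_(h < n) einv (Ah h h%:Z om))%E)) in
  let K' (j : int) (om : Omega) : \bar R :=
    ereal_inf [set (m%:R)%:E | m in [set m : nat | U j om < Ah m j om]] in
  let tau (n : int) (om : Omega) : \bar R :=
    ereal_sup [set (s%:~R)%:E | s in
      [set s : int | (s <= n)%R /\
         forall j : int, (s <= j <= n)%R -> (K' j om <= ((j - s)%:~R)%:E)%E]] in
  let R0 : set Omega := [set om | forall n : nat, (0 <= tau n%:Z om)%E] in
  P.-integrable setT prodinv ->
  (0 < P R0)%E.
Proof.
move=> Ah prodinv K' tau R0 iprod.
pose cell := B0_cell p l.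
have mcell := measurable_B0_cell p l B0_disj.
have mU := HU.1.
have AhE h j om :
    Ah h j om = A_word p (mkseq (fun k => cell (U (j - k.+1%:Z) om)) h).
  exact: A_wordE.
(* Here u_{k+1} is U_{h-1-k}: A_h reads the most recent letter first, words along time the oldest
   first, whence [rev]. *)
have AhnatE h om :
    Ah h h%:Z om = A_word p (rev (mkseq (fun i => cell (U i%:Z om)) h)).
  rewrite AhE; congr (A_word p _); apply: (@eq_from_nth _ None).
    by rewrite size_rev !size_mkseq.
  move=> k; rewrite size_mkseq => kh; rewrite nth_rev size_mkseq//.
  have hk : (h - k.+1 < h)%N by rewrite ltn_subrL/= (leq_ltn_trans (leq0n k)).
  by rewrite !nth_mkseq// subzn.
pose hit m j : set Omega := [set om | U j om < Ah m j om].
have mhit m j : measurable (hit m j).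
  have mA : measurable_fun setT (Ah m j).
    move=> _ Y mY; rewrite setTI.
    rewrite (_ : Ah m j = A_word p \o
      (fun om => mkseq (fun k => cell (U (j - k.+1%:Z) om)) m)); last exact/funext/AhE.
    rewrite comp_preimage; apply: measurable_preimage_countable => c.
    exact: (measurable_map_cells _ cell mcell nat (fun k => U (j - k.+1%:Z))
      (iota 0 m) c (fun k => mU _)).
  have := measurable_fun_ltr (mU j) mA.
  by move=> /(_ measurableT [set true] I); rewrite setTI preimage_true.
(* Only countable unions and intersections occur, so [R0] is measurable, as the final use of
   [le_measure] requires. *)
have R0E : R0 = \bigcap_n \bigcup_(s in [set s | (s <= n)%N])
    \bigcap_(j in [set j | (s <= j <= n)%N])
    \bigcup_(m in [set m | (m <= j - s)%N]) hit m j%:Z.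
  apply/seteqP; split => om H n.
    move=> _; have [s [sn Hs]] := (renewal_ge0 (fun m j => hit m j om) n).1 (H n).
    by exists s => // j /Hs[m [mj ?]]; exists m.
  apply/(renewal_ge0 (fun m j => hit m j om)); have [s sn Hs] := H n I.
  by exists s; split => // j /Hs[m mj ?]; exists m.
have mR0 : measurable R0.
  rewrite R0E; apply: bigcapT_measurable => n; apply: bigcup_measurable => s _.
  by apply: bigcap_measurableType => j _; apply: bigcup_measurable => m _.
(* The product becomes a supremum of weights for the choice of [alpha c] as [A_word p (rev c)]. *)
have prodE om : prodinv om = ereal_sup (range (fun n =>
    (\prod_(h < size (mkseq (fun i => cell (U i%:Z om)) n))
      einv (A_word p (rev (take h (mkseq (fun i => cell (U i%:Z om)) n)))))%E)).
  congr (ereal_sup (_ @` _)); apply/funext => n; rewrite size_mkseq.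
  apply: eq_bigr => h _; rewrite AhnatE; congr (einv (A_word p (rev _))).
  by rewrite /mkseq -map_take take_iota (minn_idPl (ltnW (ltn_ord h))).
rewrite (funext prodE) in iprod.
have := success_forever_gt0 P _ cell mcell (fun i => U i%:Z) (fun i => mU i%:Z)
  (fun i a => uniform_lt P U HU i%:Z a) (indep_nat P U HU)
  (fun c => A_word p (rev c)) (fun c => A_word01 p p_ge0 p_sum1 (rev c)) iprod.
move=> /lt_le_trans; apply; apply: le_measure; rewrite ?inE//.
  rewrite (_ : \bigcap_n _ = \bigcap_n hit n n%:Z).
    by apply: bigcapT_measurable.
  apply/seteqP; split => om H n _.
    by rewrite /hit /= AhnatE; exact: (H n.+1 I n (ltnSn n)).
  by move=> h hn; have := H h I; rewrite /hit /= AhnatE.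
(* The witnesses are s = 0 and m = j: U_j < A_j(U_{j-1},...,U_0) gives K'_j <= j. *)
move=> om H; rewrite R0E => n _; exists 0%N => // j _; exists j; first by rewrite /= subn0.
by rewrite /hit /= AhnatE; exact: (H j.+1 I j (ltnSn j)).
Qed.
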